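(* Let $A\in\mathbb{R}^{m\times n}$, $b\in\mathbb{R}^m$ with the linear system $Ax=b$ consistent, let $r=\operatorname{rank}(A)$ and $1\le s\le r$. Let $\lambda:=(\sigma_1^2(A),\ldots,\sigma_{\min}^2(A),0,\ldots,0)^\top\in\mathbb{R}^m$ and $\rho_{A,s}:=\dfrac{\sigma_{\min}^2(A)}{\sigma_s^2(A)+\cdots+\sigma_{\min}^2(A)}$. Assume $$0<\omega\le\frac{e_s(\lambda)}{e_{s-1}(\lambda_{-m})\|A\|_2^2}\qquad\text{and}\qquad \big(1-\sqrt{\omega\rho_{A,s}}\big)^2<\beta<1.$$ Let $x^0=x^1\in\mathbb{R}^n$ be arbitrary and let $\{x^k\}_{k\ge0}$ be generated by $$x^{k+1}=x^k-\omega A_{\mathcal{S}_k}^\dagger(A_{\mathcal{S}_k}x^k-b_{\mathcal{S}_k})+\beta(x^k-x^{k-1}),\qquad k\ge1,$$ where at each iteration $\mathcal{S}_k\sim\operatorname{Vol}_s(AA^\top)$ is drawn independently of the past. Let $x^0_*:=A^\dagger b+(I-A^\dagger A)x^0$. Then there exists a constant $c>0$ such that for all $k\ge0$, $$\big\|\mathbb{E}[x^k-x^0_*]\big\|_2^2\le\beta^k c .$$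
   Context: $\sigma_1(A)\ge\cdots\ge\sigma_r(A)=:\sigma_{\min}(A)>0$ are the nonzero singular values of $A$; $\|A\|_2=\sigma_1(A)$. For $\xi\in\mathbb{R}^p$ and $1\le\ell\le p$, $e_\ell(\xi):=\sum_{1\le i_1<\cdots<i_\ell\le p}\xi_{i_1}\cdots\xi_{i_\ell}$, and $e_0(\xi):=1$; $\lambda_{-m}\in\mathbb{R}^{m-1}$ is $\lambda$ with its last entry removed. For $\mathcal{S}\subseteq[m]$, $A_{\mathcal{S}}$ and $b_{\mathcal{S}}$ are the row submatrix of $A$ and subvector of $b$ indexed by $\mathcal{S}$, and $\dagger$ denotes the Moore–Penrose pseudoinverse. Volume sampling: $\mathcal{S}\sim\operatorname{Vol}_s(AA^\top)$ means $\mathcal{S}$ takes values in the $s$-element subsets of $[m]$ with $\mathbb{P}(\mathcal{S}=\mathcal{T})=\det(A_{\mathcal{T}}A_{\mathcal{T}}^\top)/\sum_{|\mathcal{J}|=s}\det(A_{\mathcal{J}}A_{\mathcal{J}}^\top)$. *)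

(* Defs.v *)
From HB Require Import structures.
From mathcomp Require Import all_boot all_order all_algebra.
From mathcomp Require Import boolp classical_sets.
Set Implicit Arguments. Unset Strict Implicit. Unset Printing Implicit Defensive.
Import Order.TTheory GRing.Theory Num.Theory.
Local Open Scope ring_scope.

Section Defs.
Variable R : rcfType.

Definition penrose (p q : nat) (A : 'M[R]_(p, q)) (X : 'M[R]_(q, p)) : bool :=
  [&& A *m X *m A == A, X *m A *m X == X,
      (A *m X)^T == A *m X & (X *m A)^T == X *m A].

Definition mpinv (p q : nat) (A : 'M[R]_(p, q)) : 'M[R]_(q, p) :=
  xget 0 [set X | penrose A X].

Definition eigs (p : nat) (M : 'M[R]_p) : seq R :=
  xget [::] [set l : seq R | [&& size l == p, sorted >=%R l &
                     char_poly M == \prod_(x <- l) ('X - x%:P)]].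

(* Singular values, 1-indexed: sigma A i = sqrt of the i-th largest eigenvalue of A A^T;
   the nonzero ones are sigma A 1 >= ... >= sigma A (\rank A) > 0. *)
Definition sigma (p q : nat) (A : 'M[R]_(p, q)) (i : nat) : R :=
  Num.sqrt (nth 0 (eigs (A *m A^T)) i.-1).

Definition norm2mx (p q : nat) (A : 'M[R]_(p, q)) : R := sigma A 1.

Definition sqnorm (q : nat) (v : 'cV[R]_q) : R := \sum_i v i 0 ^+ 2.

Definition elsym (xi : seq R) (l : nat) : R :=
  \sum_(S : {set 'I_(size xi)} | #|S| == l) \prod_(i in S) xi`_i.

Definition lam (p q : nat) (A : 'M[R]_(p, q)) : seq R :=
  [seq (if (i < \rank A)%N then sigma A i.+1 ^+ 2 else 0) | i <- iota 0 p].

Definition drop_last (xi : seq R) : seq R := take (size xi).-1 xi.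

Definition rho (p q : nat) (A : 'M[R]_(p, q)) (s : nat) : R :=
  sigma A (\rank A) ^+ 2 / \sum_(s <= i < (\rank A).+1) sigma A i ^+ 2.

Definition rowsS (p q : nat) (A : 'M[R]_(p, q)) (T : {set 'I_p}) : 'M[R]_(#|T|, q) :=
  rowsub (fun i : 'I_#|T| => enum_val i) A.

Definition volP (p q : nat) (A : 'M[R]_(p, q)) (s : nat) (T : {set 'I_p}) : R :=
  if #|T| == s then
    \det (rowsS A T *m (rowsS A T)^T) /
      \sum_(J : {set 'I_p} | #|J| == s) \det (rowsS A J *m (rowsS A J)^T)
  else 0.

(* Deterministic iteration for a given realisation of subsets:
   S_j = nth set0 Ss j.-1 for j >= 1.
   hb_iter k = (x^k, x^{k+1}), with x^0 = x^1 = x0 and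
   x^{j+1} = x^j - w A_{S_j}^+ (A_{S_j} x^j - b_{S_j}) + beta (x^j - x^{j-1}). *)
Fixpoint hb_iter (p q : nat) (A : 'M[R]_(p, q)) (b : 'cV[R]_p) (w beta : R)
    (x0 : 'cV[R]_q) (Ss : seq {set 'I_p}) (k : nat) : 'cV[R]_q * 'cV[R]_q :=
  match k with
  | 0 => (x0, x0)
  | k'.+1 =>
      let: (xprev, xcur) := hb_iter A b w beta x0 Ss k' in
      let S := nth (@finset.set0 _) Ss k' in
      (xcur, xcur - w *: (mpinv (rowsS A S) *m (rowsS A S *m xcur - rowsS b S))
               + beta *: (xcur - xprev))
  end.

Definition hb_x (p q : nat) (A : 'M[R]_(p, q)) (b : 'cV[R]_p) (w beta : R)
    (x0 : 'cV[R]_q) (Ss : seq {set 'I_p}) (k : nat) : 'cV[R]_q :=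
  (hb_iter A b w beta x0 Ss k).1.

(* Expectation of a random vector F(S_1,...,S_{k-1}), with S_1,...,S_{k-1} drawn
   independently from Vol_s(A A^T): the product law on (k-1)-tuples of subsets. *)
Definition expect (p q : nat) (A : 'M[R]_(p, q)) (s k : nat)
    (F : seq {set 'I_p} -> 'cV[R]_q) : 'cV[R]_q :=
  \sum_(t : (k.-1).-tuple {set 'I_p}) (\prod_(T <- t) volP A s T) *: F t.

End Defs.

(* Main.v *)
(* In expectation the iteration is linear: the mean errors [e k] satisfy
   [e k.+2 = (1 + beta) e k.+1 - w W e k.+1 - beta e k], where [W] is the mean of the
   orthogonal projectors [mpinv A_S *m A_S].  Write [A A^T = U^T D U] with [U] orthogonal and
   [D] diagonal.  For every [S],
   [det (A_S A_S^T) * v^T mpinv A_S A_S u = det (A_S (1 + u v^T) A_S^T) - det (A_S A_S^T)],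
   also when [A_S A_S^T] is singular.  Summing over [S] turns the right-hand side into
   coefficients of characteristic polynomials, which depend on [A (1 + u v^T) A^T] only up to
   similarity; taking for [u], [v] the columns of [(U A)^T] shows that [U A] diagonalizes [W],
   with eigenvalues [mu i = lambda i * e_{s-1}(lambda without i) / e_s(lambda)].
   On the range of [A^T] these satisfy [rho <= mu i] and [w mu i <= 1], so each mode of the
   error obeys a two-term recursion with non-real characteristic roots of modulus
   [sqrt beta]. *)

Require Import Defs.
From HB Require Import structures.
From mathcomp Require Import all_boot all_order all_algebra.
From mathcomp Require Import boolp classical_sets reals.
From mathcomp Require Import perm spectral complex finset ring lra.
Import Order.TTheory GRing.Theory Num.Theory.
Local Open Scope ring_scope.
Set Implicit Arguments.
Unset Strict Implicit.
Unset Printing Implicit Defensive.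

(** * Real spectral theorem *)

Section Spectral.
Variable R : rcfType.

Lemma char_poly_prod_diag (F : comUnitRingType) n (U M : 'M[F]_n) (d : 'rV[F]_n) :
  U \in unitmx -> M = invmx U *m diag_mx d *m U ->
  char_poly M = \prod_i ('X - (d 0 i)%:P).
Proof.
move=> Uu ->.
have -> : char_poly (invmx U *m diag_mx d *m U) = char_poly (diag_mx d).
  rewrite /char_poly /char_poly_mx !map_mxM /=.
  have UpU : map_mx polyC (invmx U) *m map_mx polyC U = 1%:M.
    by rewrite -map_mxM /= mulVmx // map_mx1.
  have XE : 'X%:M = map_mx polyC (invmx U) *m 'X%:M *m map_mx polyC U :> 'M_n.
    by rewrite mul_mx_scalar -scalemxAl UpU scalemx1.
  rewrite [in LHS]XE -mulmxBl -mulmxBr !det_mulmx mulrAC -det_mulmx UpU.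
  by rewrite det1 mul1r.
rewrite char_poly_trig ?diag_mx_is_trig //.
by apply: eq_bigr => i _; rewrite mxE eqxx mulr1n.
Qed.

(** Over the complexification the matrix is Hermitian, so its spectral diagonal is real, and any
    entry of it is a root of the characteristic polynomial. *)
Lemma sym_eigenvalue n (M : 'M[R]_n.+1) : M^T = M -> exists a, eigenvalue M a.
Proof.
move=> Msym; pose Mc := map_mx (real_complex R) M.
have Mh : Mc \is hermsymmx.
  apply: realsym_hermsym.
    apply/is_hermitianmxP; rewrite expr0 scale1r map_mx_id //.
    by rewrite /Mc map_trmx Msym.
  apply/mxOverP => i j; rewrite mxE; apply/complex_realP.
  by exists (M i j).
have := hermitian_spectral_diag_real Mh; set d := spectral_diag Mc => dreal.
have /orthomx_spectralP Mdef := hermitian_normalmx Mh.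
have cM := char_poly_prod_diag (spectral_unit Mc) Mdef.
have /complex_realP [a da] : d 0 0 \is Num.real by apply: (mxOverP dreal).
exists a; rewrite eigenvalue_root_char -(fmorph_root (real_complex R)) /=.
rewrite map_char_poly -/Mc cM; apply/rootP.
by rewrite horner_prod (bigD1 0) //= hornerXsubC -/d da subrr mul0r.
Qed.

Lemma rv_sqnormE n (u : 'rV[R]_n) : (u *m u^T) 0 0 = \sum_i u 0 i ^+ 2.
Proof. by rewrite mxE; apply: eq_bigr => i _; rewrite mxE. Qed.

Lemma rv_sqnorm_eq0 n (u : 'rV[R]_n) : ((u *m u^T) 0 0 == 0) = (u == 0).
Proof.
apply/eqP/eqP => [|->]; last by rewrite mul0mx mxE.
rewrite rv_sqnormE => /psumr_eq0P uz; apply/rowP => i; apply/eqP.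
by rewrite mxE -sqrf_eq0 uz // => j _; exact: sqr_ge0.
Qed.

(** [H] is the reflection that exchanges the unit vectors [e] and [v]. If [v = e], then [q = 0] and
    the convention [0^-1 = 0] turns [H] into the identity. *)
Lemma householder n (v : 'rV[R]_(1 + n)) : v *m v^T = 1%:M ->
  exists H : 'M[R]_(1 + n),
    [/\ H^T = H, H *m H = 1%:M & row_mx 1%:M 0 *m H = v].
Proof.
move=> vv; pose e : 'rV[R]_(1 + n) := row_mx 1%:M 0; pose w := v - e.
pose q := (w *m w^T) 0 0; have qE : w *m w^T = q%:M by rewrite [LHS]mx11_scalar.
have ee : e *m e^T = 1%:M.
  by rewrite tr_row_mx mul_row_col trmx0 mulmx0 addr0 trmx1 mulmx1.
have ve : v *m e^T = e *m v^T.
  by rewrite -[RHS]trmxK trmx_mul trmxK [RHS]mx11_scalar mxE -mx11_scalar.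
exists (1%:M - (2 / q) *: (w^T *m w)); split.
- by rewrite linearB /= trmx1 linearZ /= trmx_mul trmxK.
- have [q0|q0] := eqVneq q 0; first by rewrite q0 invr0 mulr0 scale0r subr0 mulmx1.
  have PP : (w^T *m w) *m (w^T *m w) = q *: (w^T *m w).
    by rewrite mulmxA -(mulmxA w^T) qE mul_mx_scalar -scalemxAl.
  rewrite mulmxBr mulmx1 mulmxBl mul1mx -scalemxAl -scalemxAr PP !scalerA.
  by move: (w^T *m w) => P; apply/matrixP => i j; rewrite !mxE; field.
have qe : q%:M = 2 *: (1%:M - e *m v^T) :> 'M_1.
  rewrite -qE /w linearB /= mulmxBl !mulmxBr vv ve ee.
  by rewrite scaler_nat mulr2n opprB.
have [q0|q0] := eqVneq q 0.
  have w0 : w = 0 by apply/eqP; rewrite -rv_sqnorm_eq0 -/q q0.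
  rewrite -/e q0 invr0 mulr0 scale0r subr0 mulmx1.
  by apply/esym/eqP; rewrite -subr_eq0 -/w w0.
rewrite -/e mulmxBr mulmx1 -scalemxAr mulmxA.
have -> : e *m w^T = (- (q / 2))%:M.
  rewrite linearB /= mulmxBr ee raddfN /= mulrC -scale_scalar_mx qe.
  by rewrite scalerA mulVf ?pnatr_eq0 // scale1r opprB.
rewrite mul_scalar_mx scalerA mulrN (_ : 2 / q * _ = 1); last by field.
by rewrite scaleNr scale1r opprK addrC subrK.
Qed.

(** Conjugation by a reflection carrying the first basis vector to a unit eigenvector gives a first
    row [(a, 0)]; by symmetry the matrix is then block diagonal, and induction handles the lower
    block. *)
Lemma sym_diagonalize n (M : 'M[R]_n) : M^T = M ->
  exists (U : 'M[R]_n) (d : 'rV[R]_n),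
    U *m U^T = 1%:M /\ M = U^T *m diag_mx d *m U.
Proof.
elim: n M => [|n IHn] M Msym.
  by exists 1%:M, 0; split; apply/matrixP => -[].
have [a /eigenvalueP [u uM u0]] := sym_eigenvalue Msym.
pose v := (Num.sqrt ((u *m u^T) 0 0))^-1 *: u.
have upos : 0 < (u *m u^T) 0 0.
  by rewrite lt_def rv_sqnorm_eq0 u0 rv_sqnormE sumr_ge0 // => i _; exact: sqr_ge0.
have vv : v *m v^T = 1%:M.
  rewrite linearZ /= -scalemxAr -scalemxAl scalerA [X in _ *: X]mx11_scalar.
  rewrite scale_scalar_mx -invfM -expr2 sqr_sqrtr ?ltW //.
  by rewrite mulVf ?gt_eqF.
have vM : v *m M = a *: v by rewrite -scalemxAl uM !scalerA mulrC.
have [H [Hs HH eH]] := @householder n v vv.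
pose N : 'M[R]_(1 + n) := H *m (M : 'M_(1 + n)) *m H.
have Ns : N^T = N by rewrite /N !trmx_mul Hs Msym mulmxA.
have eN : row_mx 1%:M 0 *m N = row_mx a%:M 0.
  by rewrite /N !mulmxA eH vM -scalemxAl -eH -mulmxA HH mulmx1 scale_row_mx scaler0 scalemx1.
have := eN; rewrite -{1}(submxK N) mul_row_block !mul1mx !mul0mx !addr0.
case/eq_row_mx => Nul Nur.
have Ndl : dlsubmx N = 0.
  by rewrite -[dlsubmx N]trmxK trmx_dlsub Ns Nur trmx0.
have [|U [d [UU Ndr]]] := IHn (drsubmx N); first by rewrite trmx_drsub Ns.
pose B : 'M[R]_(1 + n) := block_mx 1%:M 0 0 U.
have BB : B *m B^T = 1%:M.
  rewrite tr_block_mx mulmx_block !trmx0 !(mulmx0, mul0mx, addr0, add0r).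
  by rewrite trmx1 mulmx1 UU -scalar_mx_block.
have BN : B^T *m diag_mx (row_mx a%:M d : 'rV_(1 + n)) *m B = N.
  rewrite diag_mx_row tr_block_mx !mulmx_block !trmx0.
  rewrite !(mulmx0, mul0mx, addr0, add0r, mulmx1, trmx1, mul1mx) -Ndr.
  rewrite -[RHS]submxK Nul Nur Ndl; congr block_mx.
  by apply/matrixP => i j; rewrite !ord1 !mxE eqxx.
exists (B *m H), (row_mx a%:M d : 'rV_(1 + n)); split.
  by rewrite (trmx_mul B H) Hs mulmxA -(mulmxA B) HH mulmx1.
rewrite (trmx_mul B H) Hs !mulmxA -(mulmxA H) -(mulmxA H) BN.
by rewrite /N !mulmxA HH mul1mx -mulmxA HH mulmx1.
Qed.

End Spectral.

(** * Sorted eigenvalues of the Gram matrix, and its rank *)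

Section SortedSpectrum.
Variable R : rcfType.

Lemma mulmx_tr_eq0 m n (X : 'M[R]_(m, n)) : X *m X^T = 0 -> X = 0.
Proof.
move=> XX; apply/row_matrixP => i; apply/eqP; rewrite row0 -rv_sqnorm_eq0.
move/matrixP/(_ i i): XX; rewrite !mxE => XX; apply/eqP; rewrite -[RHS]XX.
by apply: eq_bigr => j _; rewrite !mxE.
Qed.

Lemma mxrank_gram m n (A : 'M[R]_(m, n)) : \rank (A *m A^T) = \rank A.
Proof.
apply/eqP; rewrite eqn_leq mxrankM_maxl /=.
have kerle : (kermx (A *m A^T) <= kermx A)%MS.
  apply/sub_kermxP; apply: mulmx_tr_eq0.
  by rewrite trmx_mul !mulmxA -(mulmxA _ A) mulmx_ker mul0mx.
have := mxrankS kerle; rewrite !mxrank_ker.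
by rewrite leq_sub2lE // rank_leq_row.
Qed.

(** [eigs] is defined by choice, so a suitable sorted list is exhibited first. Unique factorization
    makes [eigs M] a permutation of [d], and the permutation is absorbed into [U]. *)
Lemma eigs_diagonalize n (M : 'M[R]_n) : M^T = M ->
  [/\ size (eigs M) = n, sorted >=%R (eigs M) &
   exists2 U : 'M[R]_n, U *m U^T = 1%:M &
     M = U^T *m diag_mx (\row_i (eigs M)`_i) *m U].
Proof.
move=> Msym; have [U [d [UU Mdef]]] := sym_diagonalize Msym.
have UV : U^T = invmx U.
  by rewrite -[LHS]mul1mx -(mulVmx (proj1 (mulmx1_unit UU))) -mulmxA UU mulmx1.
have cM : char_poly M = \prod_(x <- [tuple d 0 i | i < n]) ('X - x%:P).
  rewrite big_map big_enum /=; apply: char_poly_prod_diag (proj1 (mulmx1_unit UU)) _.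
  by rewrite -UV.
have : [&& size (eigs M) == n, sorted >=%R (eigs M) &
    char_poly M == \prod_(x <- eigs M) ('X - x%:P)].
  apply: (@xgetPex _ [::] [set l : seq R | [&& size l == n, sorted >=%R l &
    char_poly M == \prod_(x <- l) ('X - x%:P)]]%classic); exists (sort >=%R [tuple d 0 i | i < n]).
  rewrite /mkset size_sort size_tuple eqxx sort_sorted => [/=|x y]; last exact: le_total.
  by rewrite cM; apply/eqP/perm_big; rewrite perm_sym perm_sort.
case/and3P=> /eqP sz srt /eqP; rewrite cM => /prod_XsubC_eq.
rewrite perm_sym => /tuple_permP [p pE]; split => //.
exists (perm_mx p *m U).
  by rewrite trmx_mul mulmxA -(mulmxA _ U) UU mulmx1 tr_perm_mx -perm_mxM mulgV perm_mx1.
have -> : diag_mx (\row_i (eigs M)`_i) = perm_mx p *m diag_mx d *m (perm_mx p)^T.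
  rewrite tr_perm_mx -row_permE -col_permE; apply/matrixP => i j.
  rewrite !mxE pE (nth_map i) ?size_enum_ord // nth_ord_enum tnth_mktuple.
  by rewrite (inj_eq perm_inj).
rewrite trmx_mul !mulmxA -(mulmxA U^T) tr_perm_mx -perm_mxM mulVg perm_mx1 mulmx1.
by rewrite -(mulmxA _ (perm_mx p^-1)) -perm_mxM mulVg perm_mx1 mulmx1.
Qed.

Lemma rank_sorted_diag n (d : 'rV[R]_n) k : (k <= n)%N ->
  (forall i : 'I_n, (d 0 i != 0) = (i < k)%N) -> \rank (diag_mx d) = k.
Proof.
(* Replacing the zeros of [d] by ones makes [diag_mx d'] invertible. *)
move=> kn dk; pose d' := \row_i (if (i < k)%N then d 0 i else 1).
have -> : diag_mx d = pid_mx k *m diag_mx d'.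
  apply/matrixP => i j; rewrite mul_mx_diag !mxE.
  case: eqP => [->|/eqP ij]; last by rewrite -val_eqE in ij; rewrite (negPf ij) mul0r.
  rewrite eqxx mulr1n /=; case: ifP => ik; rewrite ?mul1r ?mul0r //.
  by apply/eqP; rewrite -[_ == 0]negbK dk ik.
rewrite mxrankMfree ?rank_pid_mx // row_free_unit unitmxE det_diag.
rewrite unitfE; apply/prodf_neq0 => i _; rewrite mxE.
by case: ifP => ik; rewrite ?oner_eq0 // dk.
Qed.

Variables (m n : nat) (A : 'M[R]_(m, n)).

Lemma eigs_gram_ge0 i : 0 <= (eigs (A *m A^T))`_i.
Proof.
have [|sz _ [U UU GE]] := @eigs_diagonalize _ (A *m A^T).
  by rewrite trmx_mul trmxK.
set l := eigs _ in sz GE *.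
have [im|im] := ltnP i m; last by rewrite nth_default ?sz.
have /matrixP/(_ (Ordinal im) (Ordinal im)) : (U *m A) *m (U *m A)^T = diag_mx (\row_i l`_i).
  by rewrite trmx_mul mulmxA -(mulmxA U) GE !mulmxA UU mul1mx -mulmxA UU mulmx1.
rewrite !mxE eqxx mulr1n => <-; apply: sumr_ge0 => j _.
by rewrite [_^T _ _]mxE -expr2 sqr_ge0.
Qed.

Lemma eigs_gram_antitone i j : (i <= j)%N ->
  (eigs (A *m A^T))`_j <= (eigs (A *m A^T))`_i.
Proof.
have [|sz srt _] := @eigs_diagonalize _ (A *m A^T).
  by rewrite trmx_mul trmxK.
move=> ij; have [jm|jm] := ltnP j m; last by rewrite [leLHS]nth_default ?sz ?eigs_gram_ge0.
have im := leq_ltn_trans ij jm.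
apply: (sorted_leq_nth _ _ 0 srt); rewrite ?inE ?sz //.
  by move=> x y z xy yz; apply: le_trans yz xy.
exact: lexx.
Qed.

(** In a nonincreasing nonnegative list the positive entries are those before the first zero, at
    position [k]; so [k] is the rank of [A A^T], hence of [A]. *)
Lemma eigs_gram_gt0 i : (0 < (eigs (A *m A^T))`_i) = (i < \rank A)%N.
Proof.
have [|sz srt [U UU GE]] := @eigs_diagonalize _ (A *m A^T).
  by rewrite trmx_mul trmxK.
set l := eigs _ in sz GE *; pose k := find (pred1 0) l.
have lk j : (0 < l`_j) = (j < k)%N.
  rewrite lt_def eigs_gram_ge0 andbT; have [jk|kj] := ltnP j k.
    by have /= -> := before_find 0 jk.
  apply/negbTE; rewrite negbK eq_le eigs_gram_ge0 andbT.
  apply: (le_trans (eigs_gram_antitone kj)); have [hl|hl] := boolP (has (pred1 0) l).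
    by have /eqP -> := nth_find 0 hl.
  by rewrite nth_default //; rewrite -/l /k hasNfind.
have km : (k <= m)%N by rewrite -sz find_size.
have rd : \rank (diag_mx (\row_(i < m) l`_i)) = k.
  apply: rank_sorted_diag => //.
  by move=> j; rewrite mxE -lk lt_def eigs_gram_ge0 andbT.
have Uu := proj1 (mulmx1_unit UU).
rewrite lk -(mxrank_gram A) GE mxrankMfree ?row_free_unit //.
by rewrite eqmxMfull ?rd // row_full_unit unitmx_tr.
Qed.

Lemma sigma_sqr i : sigma A i.+1 ^+ 2 = (eigs (A *m A^T))`_i.
Proof. by rewrite /sigma sqr_sqrtr // eigs_gram_ge0. Qed.

Lemma size_lam : size (lam A) = m.
Proof. by rewrite size_map size_iota. Qed.

Lemma nth_lam i : (lam A)`_i = (eigs (A *m A^T))`_i.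
Proof.
have [|sz _ _] := @eigs_diagonalize _ (A *m A^T).
  by rewrite trmx_mul trmxK.
have [im|im] := ltnP i m; last by rewrite !nth_default ?size_lam ?sz.
rewrite (nth_map 0) ?size_iota // nth_iota // add0n sigma_sqr -eigs_gram_gt0.
by case: ltP => // l0; apply/eqP; rewrite eq_le l0 eigs_gram_ge0.
Qed.

Lemma lam_ge0 i : 0 <= (lam A)`_i.
Proof. by rewrite nth_lam eigs_gram_ge0. Qed.

Lemma lam_antitone i j : (i <= j)%N -> (lam A)`_j <= (lam A)`_i.
Proof. by rewrite !nth_lam; apply: eigs_gram_antitone. Qed.

Lemma lam_gt0 i : (0 < (lam A)`_i) = (i < \rank A)%N.
Proof. by rewrite nth_lam eigs_gram_gt0. Qed.

Lemma sigma_lam i : sigma A i.+1 ^+ 2 = (lam A)`_i.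
Proof. by rewrite sigma_sqr nth_lam. Qed.

Lemma gram_diagonalize : exists2 U : 'M[R]_m, U *m U^T = 1%:M &
  A *m A^T = U^T *m diag_mx (\row_i (lam A)`_i) *m U.
Proof.
have [|_ _ [U UU GE]] := @eigs_diagonalize _ (A *m A^T).
  by rewrite trmx_mul trmxK.
exists U => //; rewrite {1}GE; congr (_ *m diag_mx _ *m _).
by apply/rowP => i; rewrite !mxE nth_lam.
Qed.

End SortedSpectrum.

(** * Sums of principal minors *)

Section PrincipalMinors.
Variable F : comNzRingType.

(** Sylvester's identity: two block triangular factorizations of [K] compute its determinant in two
    ways. *)
Lemma det_1D_mulC m n (B : 'M[F]_(m, n)) (C : 'M[F]_(n, m)) :
  \det (1%:M + B *m C) = \det (1%:M + C *m B).
Proof.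
pose K := block_mx 1%:M (- B) C 1%:M.
have K1 : \det K = \det (1%:M + C *m B).
  have -> : K = block_mx 1%:M 0 C 1%:M *m block_mx 1%:M (- B) 0 (1%:M + C *m B).
    rewrite mulmx_block !(mulmx0, mul0mx, addr0, add0r, mulmx1, mul1mx) mulmxN.
    by rewrite addrCA addNr addr0.
  by rewrite det_mulmx det_lblock det_ublock !det1 !mul1r.
have K2 : \det K = \det (1%:M + B *m C).
  have -> : K = block_mx 1%:M (- B) 0 1%:M *m block_mx (1%:M + B *m C) 0 C 1%:M.
    rewrite mulmx_block !(mulmx0, mul0mx, addr0, add0r, mulmx1, mul1mx) mulNmx.
    by rewrite addrK.
  by rewrite det_mulmx det_lblock det_ublock !det1 !(mul1r, mulr1).
by rewrite -K2.
Qed.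

(* Rows outside [S] are replaced by those of the identity, so that all principal
   minors of [M] become determinants of matrices of the same size. *)
Definition rows_or_id n (M : 'M[F]_n) (S : {set 'I_n}) : 'M[F]_n :=
  \matrix_(i, j) if i \in S then M i j else (i == j)%:R.

Definition subM n (M : 'M[F]_n) (S : {set 'I_n}) : 'M[F]_#|S| :=
  mxsub enum_val enum_val M.

(** With [E] the row selector of [S], the left-hand matrix is [1 + E^T E (M - 1)]. Sylvester's
    identity and [E E^T = 1] leave the determinant of [E M E^T]. *)
Lemma det_rows_or_id n (M : 'M[F]_n) S : \det (rows_or_id M S) = \det (subM M S).
Proof.
pose E : 'M[F]_(#|S|, n) := rowsub enum_val 1%:M.
have EE : E *m E^T = 1%:M.
  rewrite mul_rowsub_mx mul1mx; apply/matrixP => i j; rewrite !mxE.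
  by rewrite (inj_eq enum_val_inj) eq_sym.
have EtE : E^T *m E = \matrix_(i, j) ((i == j) && (i \in S))%:R.
  apply/matrixP => i j; rewrite !mxE.
  rewrite (eq_bigr (fun k : 'I_#|S| => (enum_val k == i)%:R * (enum_val k == j)%:R)); last first.
    by move=> k _; rewrite !mxE.
  rewrite -(big_enum_val (fun k => (k == i)%:R * (k == j)%:R : F)) /=.
  have [iS|iS] := boolP (i \in S); last first.
    rewrite andbF big1 // => k kS; case: eqP => [ki|]; last by rewrite mul0r.
    by rewrite -ki kS in iS.
  rewrite andbT (bigD1 i) //= big1 ?addr0 ?eqxx ?mul1r //.
  by move=> k /andP[_ /negPf ->]; rewrite mul0r.
have -> : rows_or_id M S = 1%:M + E^T *m (E *m (M - 1%:M)).
  rewrite mulmxA EtE; apply/matrixP => i j; rewrite !mxE (bigD1 i) //= big1 => [|k ki].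
    rewrite !mxE eqxx addr0 /=; case: (i \in S); rewrite ?mul1r ?mul0r ?addr0 //.
    by rewrite addrC subrK.
  by rewrite !mxE eq_sym (negPf ki) mul0r.
rewrite det_1D_mulC mulmxBr mulmxBl mulmx1 EE addrC subrK.
congr (\det _); rewrite /E mul_rowsub_mx mul1mx; apply/matrixP => i j; rewrite !mxE.
rewrite (bigD1 (enum_val j)) //= big1 ?addr0 => [|k /negPf kj]; rewrite !mxE ?eqxx ?mulr1 //.
by rewrite eq_sym kj mulr0.
Qed.

Definition minor_sum n (M : 'M[F]_n) s : F :=
  \sum_(S : {set 'I_n} | #|S| == s) \det (subM M S).

(** In the Leibniz expansion of the determinant of [X + M], [S] collects the rows where an entry of
    [M] is picked; the other rows contribute the diagonal [X]. *)
Lemma char_poly_minors n (M : 'M[F]_n) :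
  char_poly (- M) = \sum_(S : {set 'I_n}) (\det (subM M S)) *: 'X^(n - #|S|).
Proof.
rewrite /char_poly /char_poly_mx map_mxN opprK.
transitivity (\sum_(S : {set 'I_n}) \sum_(s : 'S_n) (-1) ^+ s *
   \prod_i (if i \in S then (M i (s i))%:P else 'X *+ (i == s i))).
  rewrite exchange_big; apply: eq_bigr => s _; rewrite -big_distrr /=; congr (_ * _).
  by rewrite -bigA_distr; apply: eq_bigr => i _; rewrite !mxE addrC.
apply: eq_bigr => S _; rewrite -det_rows_or_id.
rewrite -mul_polyC -det_map_mx /= [in RHS]/determinant mulr_suml.
have -> : 'X^(n - #|S|) = \prod_i (if i \in S then 1 else 'X) :> {poly F}.
  rewrite (eq_bigr (fun i => if i \in ~: S then 'X else 1)).
    by rewrite -big_mkcond prodr_const [in RHS]cardsCs setCK card_ord.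
  by move=> i _; rewrite inE; case: (i \in S).
apply: eq_bigr => s _; rewrite -mulrA -big_split; congr (_ * _) => /=.
apply: eq_bigr => i _; rewrite !mxE; case: (i \in S); first by rewrite mulr1.
by rewrite rmorph_nat mulr_natl.
Qed.

Lemma minor_sum_coef n (M : 'M[F]_n) s : (s <= n)%N ->
  minor_sum M s = (char_poly (- M))`_(n - s).
Proof.
move=> sn; rewrite char_poly_minors coef_sum /minor_sum big_mkcond.
apply: eq_bigr => S _; rewrite coefZ coefXn.
have Sn : (#|S| <= n)%N by rewrite -[leqRHS]card_ord max_card.
have -> : (n - s == n - #|S|)%N = (#|S| == s).
  by apply/eqP/eqP => [e|->//]; rewrite -(subKn Sn) -e subKn.
by case: eqP; rewrite ?mulr1 ?mulr0.
Qed.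

Lemma minor_sum_trig n (M : 'M[F]_n) s : is_trig_mx M ->
  minor_sum M s = \sum_(S : {set 'I_n} | #|S| == s) \prod_(i in S) M i i.
Proof.
move=> /is_trig_mxP Mtrig; apply: eq_bigr => S _; rewrite -det_rows_or_id det_trig.
  by rewrite [RHS]big_mkcond; apply: eq_bigr => i _; rewrite mxE eqxx.
apply/is_trig_mxP => i j ij; rewrite mxE Mtrig //.
by rewrite -val_eqE (ltn_eqF ij) if_same.
Qed.

Lemma minor_sum_tr n (M : 'M[F]_n) s : minor_sum M^T s = minor_sum M s.
Proof.
apply: eq_bigr => S _; rewrite -det_tr; congr (\det _).
by apply/matrixP => i j; rewrite !mxE.
Qed.
End PrincipalMinors.

Lemma minor_sum_conj (F : comUnitRingType) n (U M : 'M[F]_n) s :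
  U^T *m U = 1%:M -> (s <= n)%N -> minor_sum (U^T *m M *m U) s = minor_sum M s.
Proof.
move=> UU sn; rewrite !minor_sum_coef //; congr (_`_ _).
rewrite /char_poly /char_poly_mx !map_mxN !opprK !map_mxM /=.
have UUp : map_mx polyC U^T *m map_mx polyC U = 1%:M.
  by rewrite -map_mxM UU /= map_mx1.
have XE : 'X%:M = map_mx polyC U^T *m 'X%:M *m map_mx polyC U :> 'M_n.
  by rewrite mul_mx_scalar -scalemxAl UUp scalemx1.
rewrite [in LHS]XE -mulmxDl -mulmxDr !det_mulmx mulrAC -det_mulmx UUp.
by rewrite det1 mul1r.
Qed.

(** * Elementary symmetric functions *)

Section SymmetricFunctions.
Variable R : realFieldType.

Definition esum n (d : 'I_n -> R) (s : nat) : R :=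
  \sum_(S : {set 'I_n} | #|S| == s) \prod_(i in S) d i.

(* The derivative of [esum d s] in [d i], multiplied by [d i]. *)
Definition esum_at n (d : 'I_n -> R) (s : nat) (i : 'I_n) : R :=
  \sum_(S : {set 'I_n} | (#|S| == s) && (i \in S)) \prod_(k in S) d k.

Lemma esum_remove n (d : 'I_n -> R) s j (Q : pred {set 'I_n}) :
  \sum_(S : {set 'I_n} | [&& #|S| == s.+1, j \in S & Q (S :\ j)%SET]) \prod_(k in S) d k =
  d j * \sum_(S : {set 'I_n} | [&& #|S| == s, j \notin S & Q S]) \prod_(k in S) d k.
Proof.
rewrite (reindex_onto (fun S => j |: S)%SET (fun S => S :\ j)%SET) /=; last first.
  by move=> S /and3P[_ jS _]; rewrite setD1K.
rewrite big_distrr /=; apply: eq_big => [S|S].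
  rewrite setU11 /=; have [jS|jS] := boolP (j \in S).
    rewrite andbF; apply/negbTE/negP => /andP[_ /eqP SE].
    by move: jS; rewrite -SE !inE eqxx.
  by rewrite setU1K // eqxx andbT cardsU1 jS add1n eqSS.
rewrite setU11 /= => /andP[_ /eqP SE].
have jS : j \notin S by rewrite -SE !inE eqxx.
by rewrite big_setU1.
Qed.

Variables (n : nat) (d : 'I_n -> R).
Hypothesis d_ge0 : forall i, 0 <= d i.

Let prod_ge0 (S : {set 'I_n}) : 0 <= \prod_(k in S) d k.
Proof. by apply: prodr_ge0. Qed.

Lemma esum_at_ge0 s i : 0 <= esum_at d s i.
Proof. exact: sumr_ge0. Qed.

(** Subsets containing both indices contribute equally to the two sums. Those containing only [j]
    (resp. only [i]) give [d j] (resp. [d i]) times the same sum over sets avoiding both. *)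
Lemma esum_at_compare delta s i j : 0 <= delta -> delta <= d i -> delta <= d j ->
  delta * esum_at d s j <= d j * esum_at d s i.
Proof.
move=> delta0 di dj; case: s => [|s].
  rewrite /esum_at !big_pred0 ?mulr0 // => S; rewrite cards_eq0.
    by case: eqP => // ->; rewrite inE.
  by case: eqP => // ->; rewrite inE.
have [->|ij] := eqVneq i j; first by rewrite ler_wpM2r ?esum_at_ge0.
rewrite /esum_at [in leLHS](bigID (fun S : {set _} => i \in S)) /=.
rewrite [in leRHS](bigID (fun S : {set _} => j \in S)) /= !mulrDr.
apply: lerD.
  under eq_bigl => S do rewrite andbAC.
  by apply: ler_wpM2r => //; apply: sumr_ge0.
have eqP1 a b : a != b ->
    \sum_(S : {set 'I_n} | (#|S| == s.+1) && (a \in S) && (b \notin S)) \prod_(k in S) d k =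
  d a * \sum_(S : {set 'I_n} | [&& #|S| == s, a \notin S & b \notin S]) \prod_(k in S) d k.
  move=> ab; rewrite -(esum_remove _ _ _ (fun S => b \notin S)); apply: eq_bigl => S.
  by rewrite -andbA in_setD1 [b == a]eq_sym ab.
rewrite eqP1 1?eq_sym // eqP1 // !mulrA (mulrC delta) -!mulrA; apply: ler_wpM2l => //.
under [in leRHS]eq_bigl => S do rewrite (andbC (i \notin S)).
by apply: ler_wpM2r => //; apply: sumr_ge0.
Qed.

(* Each subset of [s.+1] indices contains an index [j >= s]. *)
Lemma esum_tail_bound delta s i : 0 <= delta -> delta <= d i ->
  (forall j, d j = 0 \/ delta <= d j) ->
  delta * esum d s.+1 <= (\sum_(j < n | (s <= j)%N) d j) * esum_at d s.+1 i.
Proof.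
move=> delta0 di dj.
have le_at : esum d s.+1 <= \sum_(j < n | (s <= j)%N) esum_at d s.+1 j.
  rewrite /esum_at (exchange_big_dep (fun S : {set 'I_n} => #|S| == s.+1)) /=; last first.
    by move=> j S _ /andP[].
  apply: ler_sum => S /eqP Ss.
  have [j /andP[jS sj]] : exists j : 'I_n, (j \in S) && (s <= j)%N.
    apply/existsP; apply: contraT; rewrite negb_exists => /forallP Slow.
    suff : (#|S| <= s)%N by rewrite Ss ltnn.
    rewrite cardE -(size_map val) -[leqRHS](size_iota 0).
    apply: uniq_leq_size; first by rewrite (map_inj_uniq val_inj) enum_uniq.
    move=> _ /mapP[j jS ->]; rewrite mem_iota add0n /=.
    by have := Slow j; rewrite -mem_enum jS /= -ltnNge.
  rewrite [leRHS](bigD1 j) /= ?sj ?jS ?Ss ?eqxx //.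
  by rewrite lerDl; apply: sumr_ge0.
apply: (le_trans (ler_wpM2l delta0 le_at)); rewrite mulr_sumr mulr_suml.
(* A vanishing [d j] kills [esum_at d s.+1 j], which settles the indices without the lower bound
   [delta]. *)
apply: ler_sum => j _; have [dj0|djd] := dj j; last exact: esum_at_compare.
rewrite dj0 mul0r /esum_at big1 ?mulr0 // => S /andP[_ jS].
by rewrite (bigD1 j) //= dj0 mul0r.
Qed.

End SymmetricFunctions.

Section Elsym.
Variable R : realType.

Lemma elsymE (xi : seq R) n l : size xi = n ->
  elsym xi l = esum (fun i : 'I_n => xi`_i) l.
Proof. by move=> <-. Qed.

(** Subsets avoiding [i] are images under [lift i], which never lowers an index; as [xi] is
    nonincreasing, each factor is at most its counterpart in [drop_last xi]. *)
Lemma esum_at_drop_last (xi : seq R) n s (i : 'I_n.+1) : size xi = n.+1 ->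
  (forall i, 0 <= xi`_i) ->
  (forall i j, (i <= j)%N -> xi`_j <= xi`_i) ->
  esum_at (fun i : 'I_n.+1 => xi`_i) s.+1 i <= xi`_i * elsym (drop_last xi) s.
Proof.
move=> sz xi0 anti.
have szd : size (drop_last xi) = n by rewrite size_take sz /= ltnSn.
rewrite (elsymE _ szd) /esum_at.
have -> : \sum_(S : {set 'I_n.+1} | (#|S| == s.+1) && (i \in S)) \prod_(k in S) xi`_k =
    \sum_(S : {set 'I_n.+1} | [&& #|S| == s.+1, i \in S & true]) \prod_(k in S) xi`_k.
  by apply: eq_bigl => S; rewrite andbT.
rewrite (esum_remove (fun i : 'I_n.+1 => xi`_i) s i predT).
apply: ler_wpM2l => //.
rewrite (reindex_onto (fun S : {set 'I_n} => lift i @: S)%SET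
                      (fun S => lift i @^-1: S)%SET) /=; last first.
  move=> S /and3P[_ iS _]; apply/setP => k; apply/imsetP/idP => [[j]|kS].
    by rewrite inE => jS ->.
  have ki : i != k by apply: contraNneq iS => ->.
  by case/unlift_some: ki => j kj _; exists j; rewrite // inE -kj.
rewrite /esum (eq_bigl (fun S : {set 'I_n} => #|S| == s)) => [|S]; last first.
  rewrite (card_imset _ (@lift_inj _ i)) andbT.
  have -> : i \notin (lift i @: S)%SET.
    by apply/imsetP => -[j _ /eqP]; rewrite (negPf (neq_lift i j)).
  rewrite (_ : (_ == S) = true) ?andbT //; apply/eqP/setP => j.
  by rewrite inE mem_imset //; exact: lift_inj.
apply: ler_sum => S _; rewrite big_imset /=; last by move=> j k _ _; exact: lift_inj.
apply: ler_prod => j _; rewrite xi0 /= nth_take /= ?sz //.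
by apply: anti; rewrite /bump leq_addl.
Qed.
End Elsym.

(** * The mean projector under volume sampling *)

Section ExpectedProjector.
Variable R : realType.

Lemma mpinv_penrose p q (B : 'M[R]_(p, q)) X : penrose B X -> penrose B (mpinv B).
Proof. by move=> BX; apply: (@xgetPex _ 0 [set Y | penrose B Y]%classic); exists X. Qed.

(** [B^T (B B^T)^-1] is a Penrose inverse, so [X = mpinv B] satisfies the Penrose equations. From
    [B X B = B] and the symmetry of [X B] follow [X^T = (B B^T)^-1 B] and [X B = B^T X^T]. *)
Lemma mpinv_row_free p q (B : 'M[R]_(p, q)) : B *m B^T \in unitmx ->
  mpinv B *m B = B^T *m invmx (B *m B^T) *m B.
Proof.
move=> Bu; have GT : (B *m B^T)^T = B *m B^T by rewrite trmx_mul trmxK.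
have /mpinv_penrose/and4P[/eqP BXB _ _ /eqP XBs] :
    penrose B (B^T *m invmx (B *m B^T)).
  have BX1 : B *m (B^T *m invmx (B *m B^T)) = 1%:M by rewrite mulmxA mulmxV.
  rewrite /penrose BX1 mul1mx -mulmxA BX1 mulmx1 trmx1 !eqxx /=.
  by rewrite !trmx_mul trmxK trmx_inv GT !mulmxA.
have XtE : (mpinv B)^T = invmx (B *m B^T) *m B.
  rewrite -[LHS](mulKmx Bu); congr (_ *m _).
  by rewrite -mulmxA -trmx_mul XBs mulmxA.
by rewrite -[LHS]XBs trmx_mul XtE mulmxA.
Qed.

(** For invertible [B B^T] this is the determinant formula for a rank-one update. Otherwise a
    nonzero [w] with [w B B^T = 0] also has [w B = 0], so both determinants vanish. *)
Lemma det_gram_rank1 p q (B : 'M[R]_(p, q)) (u v : 'cV[R]_q) :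
  \det (B *m B^T) * (v^T *m (mpinv B *m B) *m u) 0 0 =
  \det (B *m (1%:M + u *m v^T) *m B^T) - \det (B *m B^T).
Proof.
have [Bu|] := boolP (B *m B^T \in unitmx).
  rewrite mpinv_row_free //.
  have -> : B *m (1%:M + u *m v^T) *m B^T =
      (B *m B^T) *m (1%:M + (invmx (B *m B^T) *m B *m u) *m (v^T *m B^T)).
    rewrite mulmxDr mulmxDl mulmx1 mulmxDr mulmx1; congr (_ + _).
    by rewrite !mulmxA mulmxV // mul1mx.
  rewrite det_mulmx det_1D_mulC [X in \det (_ + X)]mx11_scalar -raddfD /= det_scalar1.
  by rewrite !mulmxA mulrDr mulr1 addrC addKr.
rewrite unitmxE unitfE negbK => /eqP B0; rewrite B0 mul0r subr0.
apply/esym/eqP/det0P; have /eqP/det0P[w w0 wB] := B0; exists w => //.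
have -> : w *m (B *m (1%:M + u *m v^T) *m B^T) = (w *m B) *m (1%:M + u *m v^T) *m B^T.
  by rewrite !mulmxA.
rewrite (mulmx_tr_eq0 (X := w *m B)) ?mul0mx //.
by rewrite trmx_mul mulmxA -(mulmxA w) wB mul0mx.
Qed.

Variables (m n : nat) (A : 'M[R]_(m, n)) (s : nat).

Lemma gram_rowsS (X : 'M[R]_n) T :
  rowsS A T *m X *m (rowsS A T)^T = subM (A *m X *m A^T) T.
Proof.
apply/matrixP => i j; rewrite !mxE; apply: eq_bigr => k _; rewrite !mxE.
by congr (_ * _); apply: eq_bigr => l _; rewrite !mxE.
Qed.

Lemma gram_rowsS1 T : rowsS A T *m (rowsS A T)^T = subM (A *m A^T) T.
Proof. by have := gram_rowsS 1%:M T; rewrite !mulmx1. Qed.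

Definition mean_proj : 'M[R]_n :=
  \sum_(T : {set 'I_m}) volP A s T *: (mpinv (rowsS A T) *m rowsS A T).

Lemma volP_minors T : volP A s T =
  (if #|T| == s then \det (subM (A *m A^T) T) else 0) / minor_sum (A *m A^T) s.
Proof.
rewrite /volP; case: ifP; rewrite ?mul0r // => _.
by rewrite gram_rowsS1; congr (_ / _); apply: eq_bigr => J _; rewrite gram_rowsS1.
Qed.

Lemma volP_sum1 : minor_sum (A *m A^T) s != 0 -> \sum_T volP A s T = 1.
Proof.
move=> Z0; under eq_bigr => T _ do rewrite volP_minors.
by rewrite -mulr_suml -big_mkcond /= divff.
Qed.

Lemma mean_proj_form (u v : 'cV[R]_n) :
  (v^T *m mean_proj *m u) 0 0 =
  (minor_sum (A *m (1%:M + u *m v^T) *m A^T) s - minor_sum (A *m A^T) s)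
    / minor_sum (A *m A^T) s.
Proof.
rewrite /mean_proj mulmx_sumr mulmx_suml summxE -sumrB mulr_suml.
rewrite [RHS]big_mkcond /=; apply: eq_bigr => T _.
rewrite -scalemxAr -scalemxAl mxE volP_minors.
case: ifP => _; last by rewrite !mul0r.
by rewrite mulrAC -gram_rowsS -gram_rowsS1 -det_gram_rank1.
Qed.

(** This keeps the mean error in the range of [A^T]. In the nonsingular case the projector starts
    with [A_T^T], a selection of columns of [A^T]; singular subsets have probability zero. *)
Lemma mean_proj_range : exists X, mean_proj = A^T *m X.
Proof.
suff H (T : {set 'I_m}) : exists X, volP A s T *: (mpinv (rowsS A T) *m rowsS A T) = A^T *m X.
  have [X XE] := choice H; exists (\sum_T X T).
  by rewrite mulmx_sumr; apply: eq_bigr => T _; rewrite XE.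
have [Tu|Tu] := boolP (rowsS A T *m (rowsS A T)^T \in unitmx).
  exists (volP A s T *: ((rowsS 1%:M T)^T *m invmx (rowsS A T *m (rowsS A T)^T) *m rowsS A T)).
  rewrite mpinv_row_free // -scalemxAr !mulmxA; congr (_ *: (_ *m _ *m _)).
  by apply/matrixP => i j; rewrite -trmx_mul /rowsS mul_rowsub_mx mul1mx.
exists 0; rewrite mulmx0 volP_minors -gram_rowsS1.
by move: Tu; rewrite unitmxE unitfE negbK => /eqP->; rewrite if_same mul0r scale0r.
Qed.

(** The factor [d i] is the squared norm of row [i] of [U A]. For columns [a], [b] of [(U A)^T] the
    perturbed Gram matrix is conjugate to [D] plus [d a * d b] at position [(a, b)], which alters
    the minor sums only if [a = b]. *)
Lemma mean_proj_diagonalize (U : 'M[R]_m) (d : 'I_m -> R) : (s <= m)%N ->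
  U *m U^T = 1%:M -> A *m A^T = U^T *m diag_mx (\row_i d i) *m U ->
  U *m A *m mean_proj *m (U *m A)^T =
    diag_mx (\row_i (d i * (esum_at d s i / esum d s))).
Proof.
move=> sm UU GE; have UtU : U^T *m U = 1%:M by rewrite mulmx1C.
have ZE : minor_sum (A *m A^T) s = esum d s.
  rewrite GE minor_sum_conj // minor_sum_trig ?diag_mx_is_trig //.
  by apply: eq_bigr => S _; apply: eq_bigr => i _; rewrite !mxE eqxx mulr1n.
apply/matrixP => b a; pose vec c : 'cV[R]_n := (U *m A)^T *m delta_mx c 0.
have vecT c : (vec c)^T = delta_mx 0 c *m (U *m A).
  by rewrite trmx_mul trmxK trmx_delta.
have -> : (U *m A *m mean_proj *m (U *m A)^T) b a = ((vec b)^T *m mean_proj *m vec a) 0 0.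
  rewrite vecT /vec mulmxA -!(mulmxA (delta_mx 0 b)) -rowE -colE !mxE.
  by apply: eq_bigr => i _; rewrite !mxE.
rewrite mean_proj_form ZE.
have -> : A *m (1%:M + vec a *m (vec b)^T) *m A^T =
    U^T *m (diag_mx (\row_i d i) + (d a * d b) *: delta_mx a b) *m U.
  have Avec c : A *m vec c = d c *: (U^T *m delta_mx c 0).
    rewrite /vec trmx_mul !mulmxA GE -(mulmxA _ U) UU mulmx1 -mulmxA scalemxAr.
    congr (_ *m _); apply/matrixP => i j; rewrite mul_diag_mx !mxE.
    by case: eqP => [->|]; rewrite ?mulr0.
  rewrite mulmxDr mulmxDl mulmx1 GE mulmxDr mulmxDl; congr (_ + _).
  rewrite mulmxA -mulmxA -trmx_mul !Avec linearZ /= -scalemxAl -scalemxAr scalerA.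
  rewrite -scalemxAr -scalemxAl trmx_mul trmxK trmx_delta; congr (_ *: _).
  by rewrite !mulmxA -(mulmxA U^T) mul_delta_mx.
rewrite minor_sum_conj //; set M : 'M[R]_m := _ + _.
have ME i j : M i j = (if i == j then d i else 0) +
    (if (i == a) && (j == b) then d a * d b else 0).
  by rewrite !mxE; do 2!case: ifP => _; rewrite ?mulr1 ?mulr0.
(* With one extra entry at [(a, b)], [M] is lower triangular if [b <= a]; otherwise its transpose
   is. *)
have MS : minor_sum M s = \sum_(S : {set 'I_m} | #|S| == s) \prod_(i in S) M i i.
  have trigP (i j : 'I_m) : (i < j)%N -> (i == j) = false.
    by apply: contraTF => /eqP ->; rewrite ltnn.
  have [ab|ba] := ltnP a b; last first.
    apply: minor_sum_trig; apply/is_trig_mxP => i j ij; rewrite ME trigP // add0r.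
    by case: ifP => // /andP[/eqP ia /eqP jb]; move: ij; rewrite ia jb ltnNge ba.
  rewrite -minor_sum_tr minor_sum_trig.
    by apply: eq_bigr => S _; apply: eq_bigr => i _; rewrite mxE.
  apply/is_trig_mxP => i j ij; rewrite mxE ME eq_sym trigP // add0r.
  by case: ifP => // /andP[/eqP ja /eqP ib]; move: ij; rewrite ja ib ltnNge ltnW.
rewrite MS [RHS]mxE [_ 0 b]mxE; have [ba|ba] := eqVneq b a; last first.
  rewrite mulr0n; apply/eqP; rewrite mulf_eq0 subr_eq0; apply/orP; left; apply/eqP.
  apply: eq_bigr => S _; apply: eq_bigr => i _; rewrite ME eqxx.
  case: ifP => [/andP[/eqP -> /eqP ab]|]; last by rewrite addr0.
  by rewrite ab eqxx in ba.
rewrite {}ba in ME *.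
rewrite mulr1n mulrA; congr (_ / _); rewrite /esum_at /esum -sumrB.
rewrite [RHS]mulr_sumr big_mkcondr /=; apply: eq_bigr => S _.
case: ifP => aS; last first.
  rewrite (eq_bigr d) ?subrr // => i iS; rewrite ME eqxx andbb.
  case: eqP => [ia|_]; last by rewrite addr0.
  by rewrite -ia iS in aS.
have Mprod : \prod_(i in S | i != a) M i i = \prod_(i in S | i != a) d i.
  by apply: eq_bigr => i /andP[_ /negPf ia]; rewrite ME eqxx ia addr0.
have Maa : M a a = d a + d a * d a by rewrite ME !eqxx.
rewrite (bigD1 a) // [X in _ - X](bigD1 a) // [X in _ = _ * X](bigD1 a) //=.
rewrite Mprod Maa; ring.
Qed.

End ExpectedProjector.

(** * Mean error of the heavy ball iteration *)

Section Dynamics.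
Variable R : realType.

(* [a k.+1 ^+ 2 - p * a k.+1 * a k + beta * a k ^+ 2] is multiplied by [beta] at each step
   and is positive definite exactly when the characteristic roots are not real. *)
Lemma oscillating_bound (beta p : R) (a : nat -> R) : p ^+ 2 < 4 * beta ->
  (forall k, a k.+2 = p * a k.+1 - beta * a k) ->
  exists2 C, 0 <= C & forall k, a k ^+ 2 <= beta ^+ k * C.
Proof.
move=> pb rec; have g0 : 0 < beta - p ^+ 2 / 4 by lra.
pose Q k := a k.+1 ^+ 2 - p * a k.+1 * a k + beta * a k ^+ 2.
have Qk k : Q k = beta ^+ k * Q 0%N.
  elim: k => [|k IHk]; first by rewrite mul1r.
  by rewrite exprS -mulrA -IHk /Q rec; ring.
have aQ k : (beta - p ^+ 2 / 4) * a k ^+ 2 <= Q k.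
  have -> : Q k = (a k.+1 - p / 2 * a k) ^+ 2 + (beta - p ^+ 2 / 4) * a k ^+ 2.
    by rewrite /Q; field.
  by rewrite lerDr sqr_ge0.
exists (Q 0%N / (beta - p ^+ 2 / 4)).
  by apply: divr_ge0 (ltW g0); apply: le_trans (aQ 0%N); rewrite mulr_ge0 ?sqr_ge0 ?ltW.
by move=> k; rewrite mulrA -Qk ler_pdivlMr // mulrC.
Qed.

(** With [r] the root of [beta], the difference factors as
    [(theta - (1 - r)^2) ((1 + r)^2 - theta)]. The first factor is positive because [0 < 1 - r < q],
    the second because [theta <= 1]. *)
Lemma discriminant_lt0 (theta q beta : R) : 0 <= q -> q ^+ 2 <= theta -> theta <= 1 ->
  (1 - q) ^+ 2 < beta -> beta < 1 -> (1 + beta - theta) ^+ 2 < 4 * beta.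
Proof.
move=> q0 qt t1 qb b1.
have b0 : 0 < beta by apply: le_lt_trans (sqr_ge0 _) qb.
set r := Num.sqrt beta; have r2 : r ^+ 2 = beta by rewrite sqr_sqrtr ?ltW.
have r0 : 0 < r by rewrite sqrtr_gt0.
have q1 : q <= 1 by case: leP => // h; nra.
have qr : 1 - q < r.
  by case: ltP => // h; nra.
have r1 : r < 1 by case: ltP => // h; nra.
have rq : (1 - r) ^+ 2 < q ^+ 2.
  by nra.
rewrite -r2 -subr_gt0.
have -> : 4 * r ^+ 2 - (1 + r ^+ 2 - theta) ^+ 2 =
  (theta - (1 - r) ^+ 2) * ((1 + r) ^+ 2 - theta) by ring.
by apply: mulr_gt0; nra.
Qed.

Lemma big_tuple_rcons (V : nmodType) (T : finType) k (F : seq T -> V) :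
  \sum_(t : k.+1.-tuple T) F t = \sum_(t : k.-tuple T) \sum_x F (rcons t x).
Proof.
rewrite pair_big /= (reindex (fun p : k.-tuple T * T => [tuple of rcons p.1 p.2])) //=.
exists (fun t => ([tuple of belast (thead t) (behead t)], last (thead t) (behead t))).
  move=> [t x] _; congr (_, _) => /=.
    apply: val_inj => /=; case: t => -[|y s] sz /=; first by case: k sz.
    by rewrite /thead (tnth_nth y) /= belast_rcons.
  by case: t => -[|y s] sz /=; rewrite /thead (tnth_nth x) //= last_rcons.
by move=> t _; apply: val_inj => /=; rewrite -lastI [in RHS](tuple_eta t).
Qed.

Variables (m n : nat) (A : 'M[R]_(m, n)) (b : 'cV[R]_m) (w beta : R) (x0 : 'cV[R]_n).

Lemma hb_iter_rcons Ss T k : (k <= size Ss)%N ->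
  hb_iter A b w beta x0 (rcons Ss T) k = hb_iter A b w beta x0 Ss k.
Proof.
elim: k => //= k IHk kS; rewrite IHk 1?ltnW //.
by rewrite nth_rcons kS.
Qed.

Variables (s : nat) (xs : 'cV[R]_n).
Hypothesis Axs : A *m xs = b.
Hypothesis vol1 : \sum_T volP A s T = 1.

(** Consistency [A xs = b] turns the sampled residual into [A_S] applied to the error. *)
Lemma hb_iterS Ss k : let z := hb_iter A b w beta x0 Ss k in
  let S := nth set0 Ss k in
  (hb_iter A b w beta x0 Ss k.+1).2 - xs =
  (z.2 - xs) - w *: (mpinv (rowsS A S) *m rowsS A S *m (z.2 - xs)) +
    beta *: ((z.2 - xs) - (z.1 - xs)).
Proof.
move=> z S /=; rewrite -/z -/S; case: z => x y /=.
rewrite opprB addrA subrK -Axs [in LHS]/rowsS -/(rowsS A S) -mul_rowsub_mx -/(rowsS A S).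
by rewrite -mulmxBr mulmxA addrAC; congr (_ + _); rewrite addrAC.
Qed.

Definition mean_err k : 'cV[R]_n :=
  expect A s k (fun Ss => hb_x A b w beta x0 Ss k - xs).

(** After [k] draws the second component of [hb_iter] is the iterate of index [k.+1]. *)
Let nexterr k : 'cV[R]_n := \sum_(t : k.-tuple {set 'I_m})
  (\prod_(T <- t) volP A s T) *: ((hb_iter A b w beta x0 t k).2 - xs).

Lemma mean_err0 : mean_err 0 = x0 - xs.
Proof.
rewrite /mean_err /expect /= (big_pred1 [tuple]) ?big_nil ?scale1r // => t.
by apply/esym/eqP; apply: tuple0.
Qed.

Let mean_errS k : mean_err k.+1 = nexterr k.
Proof.
apply: eq_bigr => t _; rewrite /hb_x /=.
by case: (hb_iter _ _ _ _ _ _ _).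
Qed.

(** [expect] averages over [k.-1] draws only; one more draw, of total weight 1, puts [mean_err k]
    and [mean_err k.+1] on the same tuples. For [k = 0] the tuples are already empty. *)
Let mean_errE k : mean_err k = \sum_(t : k.-tuple {set 'I_m})
  (\prod_(T <- t) volP A s T) *: ((hb_iter A b w beta x0 t k).1 - xs).
Proof.
case: k => [//|k]; rewrite mean_errS (big_tuple_rcons _ (fun Ss =>
  (\prod_(T <- Ss) volP A s T) *: ((hb_iter A b w beta x0 Ss k.+1).1 - xs))); apply: eq_bigr => t _.
rewrite -[LHS]scale1r -[X in X *: _ = _]vol1 scaler_suml; apply: eq_bigr => T _.
lazy beta; rewrite scalerA big_rcons [X in _ = X *: _]mulrC.
congr (_ *: (_ - _)); rewrite /= hb_iter_rcons ?size_tuple //.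
by case: (hb_iter _ _ _ _ _ _ _).
Qed.

Lemma mean_err1 : mean_err 1 = mean_err 0.
Proof. by rewrite mean_errS mean_errE. Qed.

Lemma mean_errSS k : mean_err k.+2 =
  mean_err k.+1 - w *: (mean_proj A s *m mean_err k.+1) +
    beta *: (mean_err k.+1 - mean_err k).
Proof.
rewrite mean_errS /nexterr (big_tuple_rcons _ (fun Ss =>
  (\prod_(T <- Ss) volP A s T) *: ((hb_iter A b w beta x0 Ss k.+1).2 - xs))).
rewrite mean_errS (mean_errE k) /nexterr.
rewrite -sumrB mulmx_sumr !scaler_sumr -sumrB -big_split /=; apply: eq_bigr => t _.
set z := hb_iter A b w beta x0 t k; set c := \prod_(T <- t) _.
(* The weight [c] of the past factors out, so averaging over the last draw replaces its projector by
   [mean_proj]. *)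
transitivity (\sum_T volP A s T *: (c *: (z.2 - xs) + beta *: (c *: (z.2 - xs) - c *: (z.1 - xs)))
   - w *: (\sum_T volP A s T *: (mpinv (rowsS A T) *m rowsS A T) *m (c *: (z.2 - xs)))).
  rewrite scaler_sumr -sumrB; apply: eq_bigr => T _.
  lazy beta; rewrite big_rcons -/c hb_iterS hb_iter_rcons ?size_tuple // -/z.
  rewrite nth_rcons size_tuple ltnn eqxx.
  rewrite -scalemxAl -scalemxAr; move: (_ *m _ *m _) => v.
  by apply/matrixP => i j; rewrite !mxE /=; ring.
rewrite -mulmx_suml -scaler_suml vol1 scale1r -/(mean_proj A s) addrAC.
by [].
Qed.

End Dynamics.

(** * Pseudoinverse from the spectral decomposition, and modes of the error *)

Section Rate.
Variable R : realType.

(** The witness is [A^T (A A^T)^+], where the nonzero entries of [D] are inverted and [0^-1 = 0].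
    The identity [P A = A] holds because [P A - A] times its transpose is zero. *)
Lemma penrose_gram m n (A : 'M[R]_(m, n)) : exists X, penrose A X.
Proof.
have [U UU GE] := gram_diagonalize A; have UtU : U^T *m U = 1%:M by rewrite mulmx1C.
pose D := diag_mx (\row_(i < m) (lam A)`_i).
pose Dp := diag_mx (\row_(i < m) ((lam A)`_i)^-1).
pose P := U^T *m (D *m Dp) *m U; pose X := A^T *m (U^T *m Dp *m U).
have AX : A *m X = P.
  by rewrite /X mulmxA GE !mulmxA -(mulmxA _ U) UU mulmx1 /P !mulmxA.
have Ps : P^T = P.
  by rewrite /P !trmx_mul trmxK !tr_diag_mx mulmxA diag_mxC.
have DDD : D *m Dp *m D = D.
  rewrite !mulmx_diag; congr diag_mx; apply/rowP => i; rewrite !mxE.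
  by have [->|l0] := eqVneq (lam A)`_i 0; rewrite ?mulr0 // mulfV ?mul1r.
have PG : P *m (A *m A^T) = A *m A^T.
  by rewrite GE /P !mulmxA -(mulmxA _ U) UU mulmx1 -!(mulmxA U^T) DDD.
have PA : P *m A = A.
  apply/eqP; rewrite -subr_eq0; apply/eqP; apply: mulmx_tr_eq0.
  have -> : (P *m A - A)^T = A^T *m (P - 1%:M)^T.
    by rewrite -trmx_mul mulmxBl mul1mx.
  by rewrite mulmxA mulmxBl -mulmxA PG subrr mul0mx.
have DpP : Dp *m (D *m Dp) = Dp.
  rewrite !mulmx_diag; congr diag_mx; apply/rowP => i; rewrite !mxE.
  by have [->|l0] := eqVneq (lam A)`_i 0; rewrite ?invr0 ?mul0r // mulrA mulVf ?mul1r.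
exists X; rewrite /penrose AX PA Ps !eqxx /= -mulmxA AX.
rewrite /X /P -!mulmxA (mulmxA U) UU mul1mx (mulmxA D) (mulmxA Dp) DpP !mulmxA eqxx /=.
by rewrite !trmx_mul !trmxK tr_diag_mx !mulmxA.
Qed.

Lemma esum_lam_gt0 m n (A : 'M[R]_(m, n)) s : (s <= \rank A)%N ->
  0 < esum (fun i : 'I_m => (lam A)`_i) s.
Proof.
move=> sr; have sm : (s <= m)%N := leq_trans sr (rank_leq_row A).
rewrite /esum (bigD1 [set i : 'I_m | (i < s)%N]) /=; last first.
  rewrite cardE -(size_map val) -[X in _ == X](size_iota 0 s); apply/eqP/perm_size.
  apply: uniq_perm; rewrite ?iota_uniq ?(map_inj_uniq val_inj) ?enum_uniq //.
  move=> i; rewrite mem_iota add0n /=; apply/mapP/idP => [[j]|si].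
    by rewrite mem_enum inE => js ->.
  by exists (Ordinal (leq_trans si sm)); rewrite // mem_enum inE.
apply: ltr_pwDl.
  apply: prodr_gt0 => i; rewrite inE => si; rewrite lam_gt0.
  exact: leq_trans sr.
by apply: sumr_ge0 => S _; apply: prodr_ge0 => i _; exact: lam_ge0.
Qed.

(** With [z = U y], the modes of [A^T y] are [d i * z i] and its squared norm is the sum of the
    [d i * z i ^+ 2]. Where [d i = 0], both terms vanish since [0^-1 = 0]. *)
Lemma sqnorm_range m n (A : 'M[R]_(m, n)) (U : 'M[R]_m) (d : 'I_m -> R) (y : 'cV[R]_m) :
  U *m U^T = 1%:M -> A *m A^T = U^T *m diag_mx (\row_i d i) *m U ->
  sqnorm (A^T *m y) = \sum_i (d i)^-1 * (U *m A *m (A^T *m y)) i 0 ^+ 2.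
Proof.
move=> UU GE.
have fE : U *m A *m (A^T *m y) = diag_mx (\row_i d i) *m (U *m y).
  by rewrite !mulmxA -(mulmxA U) GE !mulmxA UU mul1mx.
have -> : sqnorm (A^T *m y) = ((A^T *m y)^T *m (A^T *m y)) 0 0.
  by move: (A^T *m y) => v; rewrite mxE; apply: eq_bigr => i _; rewrite mxE -expr2.
rewrite trmx_mul trmxK mulmxA -(mulmxA y^T) GE.
have -> : y^T *m (U^T *m diag_mx (\row_i d i) *m U) *m y =
    (U *m y)^T *m (diag_mx (\row_i d i) *m (U *m y)).
  by rewrite trmx_mul !mulmxA.
rewrite {}fE; move: (U *m y) => z.
rewrite mxE; apply: eq_bigr => i _; rewrite mul_diag_mx !mxE.
have [->|d0] := eqVneq (d i) 0; first by rewrite invr0 !mul0r mulr0.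
by field.
Qed.

(** Since [e1 = (U A)^T (U y)], the diagonalization of [mean_proj] applies, and its factor [d i]
    combines with [U y] into the mode of [e1]. *)
Lemma mode_recursion m n (A : 'M[R]_(m, n)) s (U : 'M[R]_m) (d : 'I_m -> R) w beta
    (e0 e1 e2 : 'cV[R]_n) (y : 'cV[R]_m) i :
  (s <= m)%N ->
  U *m U^T = 1%:M -> A *m A^T = U^T *m diag_mx (\row_i d i) *m U ->
  e1 = A^T *m y ->
  e2 = e1 - w *: (mean_proj A s *m e1) + beta *: (e1 - e0) ->
  (U *m A *m e2) i 0 =
  (1 + beta - w * (esum_at d s i / esum d s)) * (U *m A *m e1) i 0
     - beta * (U *m A *m e0) i 0.
Proof.
move=> sm UU GE e1E ->.
have UtU : U^T *m U = 1%:M by rewrite mulmx1C.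
have WE : U *m A *m (mean_proj A s *m e1) =
    diag_mx (\row_i (d i * (esum_at d s i / esum d s))) *m (U *m y).
  rewrite -(mean_proj_diagonalize sm UU GE) trmx_mul e1E !mulmxA.
  by rewrite -[in RHS](mulmxA _ U^T U) UtU mulmx1.
have fE : (U *m A *m e1) i 0 = d i * (U *m y) i 0.
  by rewrite e1E !mulmxA -(mulmxA U) GE !mulmxA UU mul1mx -mulmxA mul_diag_mx !mxE.
have {}WE : (U *m A *m (mean_proj A s *m e1)) i 0 =
    esum_at d s i / esum d s * (U *m A *m e1) i 0.
  rewrite WE fE; move: (U *m y) => z.
  by rewrite mul_diag_mx !mxE; ring.
have entry (u v : 'cV[R]_m) : ((u + v) i 0 = u i 0 + v i 0)%R by rewrite mxE.
have entryN (u : 'cV[R]_m) : ((- u) i 0 = - u i 0)%R by rewrite mxE.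
have entryZ c (u : 'cV[R]_m) : (c *: u) i 0 = c * u i 0 by rewrite mxE.
rewrite mulmxDr mulmxBr -!scalemxAr mulmxBr !(entry, entryN, entryZ) WE.
ring.
Qed.

End Rate.

(** * Spectral bounds and conclusion *)

Section Final.
Variable R : realType.

(** This is [w * mu i <= 1] without denominators: omitting index [i] is bounded by omitting the last
    one, and [lambda i] by [norm2mx A ^+ 2]. *)
Lemma esum_at_upper m n (A : 'M[R]_(m.+1, n)) s w (i : 'I_m.+1) : 0 < w ->
  w <= elsym (lam A) s.+1 / (elsym (drop_last (lam A)) s * norm2mx A ^+ 2) ->
  w * esum_at (fun i : 'I_m.+1 => (lam A)`_i) s.+1 i <=
    esum (fun i : 'I_m.+1 => (lam A)`_i) s.+1.
Proof.
move=> w0; rewrite (elsymE _ (size_lam A)) /norm2mx sigma_lam; set e := esum _ _.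
set D := elsym _ _ * _ => wD.
have e0 : 0 <= e by apply: sumr_ge0 => S _; apply: prodr_ge0 => j _; exact: lam_ge0.
(* A denominator [D <= 0] would make the upper bound on [w] nonpositive. *)
have D0 : 0 < D.
  have : 0 < e / D by exact: lt_le_trans w0 wD.
  by rewrite !ltNge; apply: contraNN => D0; rewrite mulr_ge0_le0 // invr_le0.
have atD : esum_at (fun i : 'I_m.+1 => (lam A)`_i) s.+1 i <= D.
  apply: le_trans (esum_at_drop_last _ _ (size_lam A) _ _) _.
  - exact: lam_ge0.
  - exact: lam_antitone.
  rewrite /D [leRHS]mulrC; apply: ler_wpM2r; last exact: lam_antitone.
  have szd : size (drop_last (lam A)) = m by rewrite size_take size_lam /= ltnSn.
  rewrite (elsymE _ szd); apply: sumr_ge0 => S _; apply: prodr_ge0 => j _.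
  by rewrite nth_take ?size_lam // lam_ge0.
apply: le_trans (ler_wpM2l (ltW w0) atD) _.
by rewrite -ler_pdivlMr.
Qed.

(** [sigma] counts from 1 and [lam] from 0; the terms from the rank up to [m] are zero. *)
Lemma sum_sigma_tail m n (A : 'M[R]_(m, n)) s :
  \sum_(s.+1 <= i < (\rank A).+1) sigma A i ^+ 2 = \sum_(i < m | (s <= i)%N) (lam A)`_i.
Proof.
rewrite big_add1 /=; under eq_bigr => i _ do rewrite sigma_lam.
rewrite -(big_geq_mkord s m predT (fun i => (lam A)`_i)).
rewrite (big_nat_widen _ _ _ _ _ (rank_leq_row A)) [LHS]big_mkcond /=.
by apply: eq_bigr => i _; rewrite -lam_gt0; case: ltP (lam_ge0 A i) => // a b; apply/le_anti/andP.
Qed.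

(** [esum_tail_bound] is applied with [delta] the smallest nonzero eigenvalue, so that every entry
    of [lam A] is zero or at least [delta]. *)
Lemma rho_esum_at m n (A : 'M[R]_(m, n)) s (i : 'I_m) :
  (s < \rank A)%N -> (i < \rank A)%N ->
  rho A s.+1 <= esum_at (fun i : 'I_m => (lam A)`_i) s.+1 i /
    esum (fun i : 'I_m => (lam A)`_i) s.+1.
Proof.
move=> sr ir; rewrite /rho sum_sigma_tail.
have rP : (\rank A).-1.+1 = \rank A by rewrite prednK // (leq_trans _ sr).
have -> : sigma A (\rank A) ^+ 2 = (lam A)`_(\rank A).-1 by rewrite -rP sigma_lam rP.
set delta := _`_(_.-1); set L := \sum_(_ < _ | _) _.
have delta0 : 0 < delta by rewrite lam_gt0 rP.
have L0 : 0 < L.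
  have sm : (s < m)%N := leq_trans sr (rank_leq_row A).
  rewrite /L (bigD1 (Ordinal sm)) //= ltr_pwDl ?lam_gt0 //.
  by apply: sumr_ge0 => j _; exact: lam_ge0.
rewrite ler_pdivrMr // mulrAC ler_pdivlMr ?esum_lam_gt0 //.
rewrite [leRHS]mulrC; apply: esum_tail_bound.
- by move=> j; exact: lam_ge0.
- exact: ltW.
- by apply: lam_antitone; rewrite -ltnS rP.
move=> j; have [jr|rj] := ltnP j (\rank A).
  by right; apply: lam_antitone; rewrite -ltnS rP.
left; apply/eqP; rewrite eq_le lam_ge0 andbT leNgt lam_gt0 -leqNgt //.
Qed.

End Final.

Theorem theorem4p2 (R : realType) (m n : nat) (A : 'M[R]_(m, n)) (b : 'cV[R]_m)
    (s : nat) (w beta : R) (x0 : 'cV[R]_n) :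
  (exists x : 'cV[R]_n, A *m x = b) ->
  (1 <= s)%N -> (s <= \rank A)%N ->
  0 < w ->
  w <= elsym (lam A) s / (elsym (drop_last (lam A)) s.-1 * norm2mx A ^+ 2) ->
  (1 - Num.sqrt (w * rho A s)) ^+ 2 < beta -> beta < 1 ->
  let xstar := mpinv A *m b + (1%:M - mpinv A *m A) *m x0 in
  exists c : R, 0 < c /\
    forall k : nat,
      sqnorm (expect A s k (fun Ss => hb_x A b w beta x0 Ss k - xstar)) <= beta ^+ k * c.
Proof.
move=> [x Axb] s1 sr w0 wle betag beta1 xstar.
have [X XP] := penrose_gram A.
have /and4P[/eqP AXA _ _ /eqP XAs] := mpinv_penrose XP.
have Axs : A *m xstar = b.
  rewrite /xstar mulmxDr -Axb [X in X + _]mulmxA [X in X + _]mulmxA AXA.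
  by rewrite mulmxA mulmxBr mulmx1 [X in (_ - X) *m _]mulmxA AXA subrr mul0mx addr0.
(* The initial error is [A^+ A (x0 - x)], and the symmetric matrix [A^+ A] equals [A^T (A^+)^T]. *)
have x0s : x0 - xstar = A^T *m ((mpinv A)^T *m (x0 - x)).
  rewrite mulmxA -trmx_mul XAs /xstar -Axb mulmxBl mul1mx mulmxBr !mulmxA.
  move: (_ *m x) (_ *m x0) => u v.
  by apply/matrixP => i j; rewrite !mxE; ring.
pose d (i : 'I_m) := (lam A)`_i.
have sm : (s <= m)%N := leq_trans sr (rank_leq_row A).
have [U UU GE] := gram_diagonalize A.
have e0 := esum_lam_gt0 sr; rewrite -/d in e0.
have UtU : U^T *m U = 1%:M by rewrite mulmx1C.
have vol1 : \sum_T volP A s T = 1.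
  apply: volP_sum1; rewrite GE minor_sum_conj // minor_sum_trig ?diag_mx_is_trig //.
  rewrite (_ : \sum_(_ | _) _ = esum d s) ?gt_eqF //.
  by apply: eq_bigr => S _; apply: eq_bigr => i _; rewrite !mxE eqxx mulr1n.
pose E k := mean_err A b w beta x0 s xstar k.
have ESS k : E k.+2 = E k.+1 - w *: (mean_proj A s *m E k.+1) + beta *: (E k.+1 - E k).
  exact: mean_errSS.
have [Y WY] := mean_proj_range A s.
have Erange k : exists y, E k = A^T *m y.
  (* The recursion has order two, so the induction carries two consecutive errors. *)
  suff [] : (exists y, E k = A^T *m y) /\ (exists y, E k.+1 = A^T *m y) by [].
  elim: k => [|k [[y ky] [z kz]]].
    have E0 : exists y, E 0%N = A^T *m y by exists ((mpinv A)^T *m (x0 - x)); rewrite /E mean_err0.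
    by split => //; rewrite /E mean_err1.
  split; first by exists z.
  exists (z - w *: (Y *m E k.+1) + beta *: (z - y)).
  rewrite ESS WY ky -mulmxA; move: (Y *m _) => v; rewrite kz.
  by rewrite mulmxDr mulmxBr -!scalemxAr mulmxBr.
have mode i : exists C, 0 <= C /\
    forall k, (d i)^-1 * (U *m A *m E k) i 0 ^+ 2 <= beta ^+ k * C.
  have [ir|ri] := ltnP i (\rank A); last first.
    (* Beyond the rank [d i = 0], so the weight [(d i)^-1] is 0 by convention. *)
    exists 0; split => [//|k]; rewrite mulr0 (_ : d i = 0) ?invr0 ?mul0r //.
    by apply/eqP; rewrite eq_le lam_ge0 andbT leNgt lam_gt0 -leqNgt.
  have di : 0 < d i by rewrite lam_gt0.
  set theta := w * (esum_at d s i / esum d s).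
  have disc : (1 + beta - theta) ^+ 2 < 4 * beta.
    have sP : s = s.-1.+1 by rewrite prednK.
    have rho0 : 0 <= rho A s.
      by rewrite divr_ge0 ?sqr_ge0 // sumr_ge0 // => j _; exact: sqr_ge0.
    apply: (discriminant_lt0 (q := Num.sqrt (w * rho A s))) => //.
    - exact: sqrtr_ge0.
    - rewrite sqr_sqrtr; last by apply: mulr_ge0 (ltW w0) rho0.
      rewrite /theta ler_pM2l // /d sP.
      by apply: rho_esum_at; rewrite -?sP.
    rewrite /theta mulrA ler_pdivrMr // mul1r /d.
    clear -w0 wle sP; case: m A i wle => [|m'] A i; first by case: i.
    by rewrite sP; apply: esum_at_upper.
  have [C C0 CP] := oscillating_bound (a := fun k => (U *m A *m E k) i 0) disc
    (fun k => let: ex_intro y yE := Erange k.+1 in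
              mode_recursion i sm UU GE yE (ESS k)).
  exists ((d i)^-1 * C); split; first by rewrite mulr_ge0 // invr_ge0 ltW.
  by move=> k; rewrite [leRHS]mulrCA ler_pM2l ?invr_gt0.
have [C CP] := choice mode.
(* The [C i] are only known to be nonnegative; adding 1 makes the constant positive. *)
exists (1 + \sum_i C i); split.
  by rewrite ltr_pwDl // sumr_ge0 // => i _; case: (CP i).
move=> k; have [y yE] := Erange k.
have beta0 : 0 <= beta by apply: le_trans (sqr_ge0 _) (ltW betag).
rewrite -/(mean_err A b w beta x0 s xstar k) -/(E k) yE (sqnorm_range _ UU GE).
rewrite mulrDr mulr1; apply: ler_wpDl; first exact: exprn_ge0.
rewrite mulr_sumr; apply: ler_sum => i _; rewrite -yE; exact: (CP i).2.
Qed.
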